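(* For every integer $n$ with $1\le n<\omega$ there is an abelian topological group $G$ such that $G\in\mathrm{SSGP}(n)$ and $G\notin\mathrm{SSGP}(n-1)$.
   Context: All topological groups are assumed Hausdorff (equivalently, Tychonoff). $1_G$ denotes the identity of $G$, $\mathcal N(1_G)$ the set of neighborhoods of $1_G$ in $G$, and $\langle A\rangle$ the subgroup generated by $A$. The classes $\mathrm{SSGP}(n)$, $0\le n<\omega$, of (Hausdorff) topological groups are defined recursively: (a) $G\in\mathrm{SSGP}(0)$ if $G$ is the trivial group; (b) for $n\ge 0$, $G\in\mathrm{SSGP}(n+1)$ if for every $U\in\mathcal N(1_G)$ there is a family $\mathcal H$ of subgroups of $G$ such that (1) every member of $\mathcal H$ is contained in $U$, (2) $H:=\overline{\langle\bigcup\mathcal H\rangle}$ is normal in $G$, and (3) the quotient topological group $G/H$ is in $\mathrm{SSGP}(n)$. *)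

(* Defs.v *)
From HB Require Import structures.
From mathcomp Require Import all_boot generic_quotient all_classical topology.
Set Implicit Arguments.
Unset Strict Implicit.
Unset Printing Implicit Defensive.

Local Open Scope classical_set_scope.
Local Open Scope group_scope.
Local Open Scope quotient_scope.

HB.mixin Record isHausdorffTopologicalGroup G & Topological G & Group G := {
  mulg_continuous : continuous (fun xy : G * G => xy.1 * xy.2 : G);
  invg_continuous : continuous (fun x : G => x^-1 : G);
  topgroup_hausdorff : hausdorff_space G }.

#[short(type="topologicalGroupType")]
HB.structure Definition TopologicalGroup :=
  {G of Topological G & Group G & isHausdorffTopologicalGroup G}.

Definition is_subgroup (G : groupType) (K : set G) : Prop :=
  [/\ K 1, (forall x y, K x -> K y -> K (x * y)) & (forall x, K x -> K x^-1)].

Definition generated (G : groupType) (A : set G) : set G :=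
  smallest (@is_subgroup G) A.

Definition is_normal (G : groupType) (K : set G) : Prop :=
  forall x g : G, K x -> K (x ^ g).

Lemma generated_subgroup (G : groupType) (A : set G) :
  is_subgroup (generated A).
Proof.
split=> [K [[K1 KM KV] _] | x y Ax Ay K KA | x Ax K KA].
- exact: K1.
- by case: (KA) => -[_ KM _] _; apply: KM; [exact: Ax | exact: Ay].
- by case: (KA) => -[_ _ KV] _; apply: KV; exact: Ax.
Qed.

Lemma mulg_cvg (G : topologicalGroupType) (x y : G) (W : set G) :
  nbhs (x * y) W -> exists A B,
    [/\ nbhs x A, nbhs y B & forall a b, A a -> B b -> W (a * b)].
Proof.
move=> nW; have /= := @mulg_continuous G (x, y) W nW.
by move=> [[A B] /= [nA nB] AB]; exists A, B; split=> // a b Aa Bb; exact: (AB (a, b)).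
Qed.

Lemma closure_subgroup (G : topologicalGroupType) (K : set G) :
  is_subgroup K -> is_subgroup (closure K).
Proof.
move=> [K1 KM KV]; split=> [|x y Kx Ky W /mulg_cvg [A [B [nA nB AB]]] | x Kx W nW].
- exact: subset_closure.
- have [a [Ka Aa]] := Kx A nA; have [b [Kb Bb]] := Ky B nB.
  by exists (a * b); split; [exact: KM | exact: AB].
- have [a [Ka Wa]] := Kx _ (@invg_continuous G x W nW).
  by exists a^-1; split => //; exact: KV.
Qed.

Record closedSubgroup (G : topologicalGroupType) := ClosedSubgroup {
  subgroup_set :> set G;
  subgroup_setP : is_subgroup subgroup_set;
  subgroup_closed : closed subgroup_set }.

Definition closed_generated (G : topologicalGroupType) (A : set G) :
    closedSubgroup G :=
  ClosedSubgroup (closure_subgroup (generated_subgroup A))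
                 (@closed_closure G (generated A)).

Section QuotientGroup.
Variables (G : topologicalGroupType) (H : closedSubgroup G).

Definition coset_rel : rel G := fun x y => `[< subgroup_set H (x^-1 * y) >].

Lemma coset_rel_refl : reflexive coset_rel.
Proof. by move=> x; apply/asboolP; rewrite mulVg; case: (subgroup_setP H). Qed.

Lemma coset_rel_sym : symmetric coset_rel.
Proof.
have [_ _ HV] := subgroup_setP H.
by move=> x y; apply/asboolP/asboolP=> /HV; rewrite invgM invgK.
Qed.

Lemma coset_rel_trans : transitive coset_rel.
Proof.
have [_ HM _] := subgroup_setP H.
move=> y x z /asboolP Hxy /asboolP Hyz; apply/asboolP.
by have := HM _ _ Hxy Hyz; rewrite mulgA mulgK.
Qed.

Definition coset_equiv : equiv_rel G :=
  EquivRel coset_rel coset_rel_refl coset_rel_sym coset_rel_trans.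

End QuotientGroup.

(* Normality of [H] is an argument of the type, so that the group structure
   can be attached to it. *)
Definition quotient_group (G : topologicalGroupType) (H : closedSubgroup G)
  (nH : is_normal H) : Type := quotient_topology {eq_quot coset_equiv H}.

Section QuotientGroupTheory.
Variables (G : topologicalGroupType) (H : closedSubgroup G) (nH : is_normal H).

Local Notation Q := (quotient_group nH).

HB.instance Definition _ :=
  Topological.copy Q (quotient_topology {eq_quot coset_equiv H}).
HB.instance Definition _ :=
  Quotient.copy Q (quotient_topology {eq_quot coset_equiv H}).

Definition quotient_proj (x : G) : Q := \pi_Q x.

Lemma quotient_projE (x y : G) :
  quotient_proj x = quotient_proj y <-> subgroup_set H (x^-1 * y).
Proof.
split=> [/(@eqquotP _ (coset_equiv H) {eq_quot coset_equiv H}) /asboolP // | Hxy].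
by apply/(@eqquotP _ (coset_equiv H) {eq_quot coset_equiv H})/asboolP.
Qed.

Lemma quotient_projK (u : Q) : quotient_proj (repr u) = u.
Proof. exact: reprK. Qed.

Definition quotient_mul (u v : Q) : Q := quotient_proj (repr u * repr v).
Definition quotient_one : Q := quotient_proj 1.
Definition quotient_inv (u : Q) : Q := quotient_proj (repr u)^-1.

Lemma quotient_projM (x y : G) :
  quotient_proj (x * y) = quotient_mul (quotient_proj x) (quotient_proj y).
Proof.
rewrite /quotient_mul; set x' := repr _; set y' := repr _.
have /quotient_projE Hx : quotient_proj x = quotient_proj x'.
  by rewrite quotient_projK.
have /quotient_projE Hy : quotient_proj y = quotient_proj y'.
  by rewrite quotient_projK.
have [_ HM _] := subgroup_setP H.
apply/quotient_projE; have := HM _ _ (nH y Hx) Hy.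
by rewrite /conjg invgM !mulgA mulgK.
Qed.

Lemma quotient_projV (x : G) :
  quotient_proj x^-1 = quotient_inv (quotient_proj x).
Proof.
rewrite /quotient_inv; set x' := repr _.
have /quotient_projE Hx : quotient_proj x' = quotient_proj x.
  by rewrite quotient_projK.
apply/quotient_projE; have := nH x'^-1 Hx.
by rewrite /conjg !invgK !mulgA mulgV mul1g.
Qed.

Lemma quotient_mulgA : associative quotient_mul.
Proof.
move=> u v w; rewrite -(quotient_projK u) -(quotient_projK v) -(quotient_projK w).
by rewrite -!quotient_projM mulgA.
Qed.

Lemma quotient_mul1g : left_id quotient_one quotient_mul.
Proof. by move=> u; rewrite -(quotient_projK u) -quotient_projM mul1g. Qed.

Lemma quotient_mulg1 : right_id quotient_one quotient_mul.
Proof. by move=> u; rewrite -(quotient_projK u) -quotient_projM mulg1. Qed.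

Lemma quotient_mulVg : left_inverse quotient_one quotient_inv quotient_mul.
Proof.
by move=> u; rewrite -(quotient_projK u) -quotient_projV -quotient_projM mulVg.
Qed.

Lemma quotient_mulgV : right_inverse quotient_one quotient_inv quotient_mul.
Proof.
by move=> u; rewrite -(quotient_projK u) -quotient_projV -quotient_projM mulgV.
Qed.

HB.instance Definition _ := isGroup.Build Q
  quotient_mulgA quotient_mul1g quotient_mulg1 quotient_mulVg quotient_mulgV.

Lemma quotient_proj_continuous : continuous quotient_proj.
Proof. exact: pi_continuous. Qed.

Lemma quotient_proj_nbhs (x : G) (A : set G) :
  nbhs x A -> nbhs (quotient_proj x) (quotient_proj @` A).
Proof.
rewrite nbhsE => -[B [oB Bx] BA]; rewrite nbhsE.
exists (quotient_proj @` B); last exact: image_subset.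
split; last by exists x.
have -> : open (quotient_proj @` B) = open (quotient_proj @^-1` (quotient_proj @` B)).
  by [].
rewrite openE => y [b Bb /quotient_projE Hby].
have nb : nbhs (y * (y^-1 * b)) B by rewrite mulgA mulgV mul1g; apply: open_nbhs_nbhs.
have [C [D [nC nD CD]]] := mulg_cvg nb.
apply: filterS nC => c Cc; exists (c * (y^-1 * b)).
  exact: CD Cc (nbhs_singleton nD).
apply/quotient_projE; have [_ _ HV] := subgroup_setP H.
by rewrite !invgM !invgK -!mulgA mulVg mulg1.
Qed.

Lemma quotient_mul_continuous :
  continuous (fun uv : Q * Q => uv.1 * uv.2 : Q).
Proof.
move=> [u v] W /=; rewrite -(quotient_projK u) -(quotient_projK v) => nW.
have /mulg_cvg[A [B [nA nB AB]]] :
    nbhs (repr u * repr v) (quotient_proj @^-1` W).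
  by apply: quotient_proj_continuous; rewrite quotient_projM.
exists (quotient_proj @` A, quotient_proj @` B).
  by split; exact: quotient_proj_nbhs.
move=> [_ _] /= [[a Aa <-] [b Bb <-]]; have := AB _ _ Aa Bb.
by rewrite /preimage /= quotient_projM.
Qed.

Lemma quotient_inv_continuous : continuous (fun u : Q => u^-1 : Q).
Proof.
move=> u W; rewrite -(quotient_projK u) => nW.
have nV : nbhs (repr u) ((fun x : G => x^-1) @^-1` (quotient_proj @^-1` W)).
  by apply: invg_continuous; apply: quotient_proj_continuous; rewrite quotient_projV.
apply: filterS (quotient_proj_nbhs nV) => _ [a Wa <-].
by move: Wa; rewrite /preimage /= quotient_projV.
Qed.

Lemma quotient_hausdorff : hausdorff_space Q.
Proof.
move=> u v cuv; rewrite -(quotient_projK u) -(quotient_projK v).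
apply/quotient_projE; apply: subgroup_closed => W /mulg_cvg[A [B [nA nB AB]]].
have nA' : nbhs (repr u) ((fun x : G => x^-1) @^-1` A) by exact: invg_continuous.
have := cuv (quotient_proj @` _) (quotient_proj @` _).
rewrite -{1}(quotient_projK u) -{1}(quotient_projK v).
move=> /(_ _ _ (quotient_proj_nbhs nA') (quotient_proj_nbhs nB)).
move=> [_ [[a Aa <-] [b Bb /esym/quotient_projE Hab]]].
by exists (a^-1 * b); split => //; exact: AB.
Qed.

HB.instance Definition _ := isHausdorffTopologicalGroup.Build Q
  quotient_mul_continuous quotient_inv_continuous quotient_hausdorff.

End QuotientGroupTheory.

Fixpoint SSGP (n : nat) (G : topologicalGroupType) : Prop :=
  match n with
  | 0 => forall x : G, x = 1
  | m.+1 => forall U : set G, nbhs (1 : G) U ->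
      exists F : set (set G),
        [/\ (forall K, F K -> is_subgroup K),
            (forall K, F K -> K `<=` U)
          & exists nH : is_normal (closed_generated (\bigcup_(K in F) K)),
              SSGP m (quotient_group nH)]
  end.

(* Main.v *)
(** Given a group [Q] with an invariant norm, let [A] be the free abelian group
    on the set [Q], normed by
      [x |-> |p x| + sup {min(1, |f x|) : f 1-Lipschitz}]
    where [p : A -> Q] is the canonical projection and real functions on [Q] are
    extended linearly to [A].  Multiples of a nonzero [x] eventually have norm at
    least 1, and [q |-> e_q - e_0], with [e_q] the generator of [q], is a section
    of [p] continuous at 0.  The cover of [Q] is the group of periodic sequences in
    [A] with constant image in [Q], with the mean of the norm over a period.
    - An element of the kernel of the projection to [Q] is the sum of its
      restrictions to the residue classes modulo [m], each of which generates a
      subgroup in the ball of radius [1/m]; hence [Q] in SSGP(n) implies that the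
      cover is in SSGP(n+1).
    - If all multiples of a sequence have norm less than 1, then some term
      vanishes, so the sequence lies over 0.  Hence subgroups contained in the
      unit ball lie in the kernel, and since SSGP(n) passes to continuous
      homomorphic images, cover in SSGP(n+1) implies [Q] in SSGP(n).
    Iterate from the trivial group. *)

Require Import Defs.
From mathcomp Require Import all_boot.
From HB Require Import structures.
From mathcomp Require Import all_order all_algebra.
From mathcomp Require Import all_classical all_reals topology.
From mathcomp Require Import lra.
From mathcomp Require Import Rstruct.

Set Implicit Arguments.
Unset Strict Implicit.
Unset Printing Implicit Defensive.

Local Open Scope classical_set_scope.

(** * SSGP and homomorphisms *)

Section TopologicalGroups.
Local Open Scope group_scope.

Definition group_morph (G G' : groupType) (f : G -> G') : Prop :=
  forall x y, f (x * y) = f x * f y.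

Lemma group_morph1 (G G' : groupType) (f : G -> G') : group_morph f -> f 1 = 1.
Proof. by move=> fM; apply: (mulgI (f 1)); rewrite -fM !mulg1. Qed.

Lemma group_morphV (G G' : groupType) (f : G -> G') x :
  group_morph f -> f x^-1 = (f x)^-1.
Proof.
by move=> fM; apply: (mulgI (f x)); rewrite -fM !mulgV group_morph1.
Qed.

Lemma is_subgroup_preimage (G G' : groupType) (f : G -> G') (K : set G') :
  group_morph f -> is_subgroup K -> is_subgroup (f @^-1` K).
Proof.
move=> fM [K1 KM KV]; split; rewrite /preimage /=.
- by rewrite group_morph1.
- by move=> x y Kx Ky; rewrite fM; exact: KM.
- by move=> x Kx; rewrite group_morphV//; exact: KV.
Qed.

Lemma is_subgroup_image (G G' : groupType) (f : G -> G') (K : set G) :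
  group_morph f -> is_subgroup K -> is_subgroup (f @` K).
Proof.
move=> fM [K1 KM KV]; split.
- by exists 1 => //; rewrite group_morph1.
- by move=> _ _ [x Kx <-] [y Ky <-]; exists (x * y); [exact: KM | rewrite fM].
- by move=> _ [x Kx <-]; exists x^-1; [exact: KV | rewrite group_morphV].
Qed.

Lemma generated_sub (G : groupType) (A K : set G) :
  is_subgroup K -> A `<=` K -> generated A `<=` K.
Proof. by move=> sK AK x; apply. Qed.

Lemma sub_generated (G : groupType) (A : set G) : A `<=` generated A.
Proof. by move=> x Ax K [_]; apply. Qed.

Lemma commutative_normal (G : groupType) (K : set G) :
  (forall x y : G, x * y = y * x) -> is_normal K.
Proof. by move=> cG x g Kx; rewrite /conjg (cG x) mulKg. Qed.

Lemma group_morph_continuous (G G' : topologicalGroupType) (f : G -> G') :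
    group_morph f ->
    (forall W, nbhs (1 : G') W -> nbhs (1 : G) (f @^-1` W)) ->
  continuous f.
Proof.
move=> fM f1 x W; rewrite -[f x]mulg1 => /mulg_cvg[A [B [nA nB AB]]].
have := f1 _ nB; rewrite -(mulVg x) => /mulg_cvg[C [D [nC nD CD]]].
apply: filterS nD => y Dy; rewrite /preimage /= -[y](mulVKg x) fM.
by apply: AB; [exact: nbhs_singleton | exact: CD (nbhs_singleton nC) Dy].
Qed.

Lemma quotient_commutative (G : topologicalGroupType) (H : closedSubgroup G)
    (nH : is_normal H) (x y : quotient_group nH) :
  (forall x y : G, x * y = y * x) -> x * y = y * x.
Proof.
move=> cG; rewrite -(quotient_projK x) -(quotient_projK y).
by rewrite -[LHS]quotient_projM cG quotient_projM.
Qed.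

(** Evaluates [f] at a chosen representative. When [f] is a morphism that is trivial on [H], the
    choice does not matter and this is the induced map. *)
Definition quotient_lift (G : topologicalGroupType) (H : closedSubgroup G)
    (nH : is_normal H) T (f : G -> T) (u : quotient_group nH) : T :=
  f (repr u).

Section QuotientLift.
Variables (G G' : topologicalGroupType) (H : closedSubgroup G).
Variables (nH : is_normal H) (f : G -> G').
Hypotheses (fM : group_morph f) (fH : forall x, subgroup_set H x -> f x = 1).

Lemma quotient_liftE x : quotient_lift f (quotient_proj nH x) = f x.
Proof.
rewrite /quotient_lift.
have /quotient_projE/fH : quotient_proj nH (repr (quotient_proj nH x))
    = quotient_proj nH x by rewrite quotient_projK.
rewrite fM group_morphV // => /(congr1 (fun z => f (repr (quotient_proj nH x)) * z)).
by rewrite mulVKg mulg1.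
Qed.

Lemma quotient_liftM : group_morph (@quotient_lift _ _ nH _ f).
Proof.
move=> u v; rewrite -(quotient_projK u) -(quotient_projK v).
by rewrite -[X in quotient_lift _ X]quotient_projM !quotient_liftE.
Qed.

(** The projection is open, so it sends the preimage of [W] under [f] to a neighborhood. *)
Lemma quotient_lift_continuous :
  continuous f -> continuous (@quotient_lift _ _ nH _ f).
Proof.
move=> fc u W; rewrite -(quotient_projK u) quotient_liftE => nW.
apply: filterS (quotient_proj_nbhs nH (fc _ _ nW)) => _ [x Wx <-].
by rewrite /preimage /= quotient_liftE.
Qed.

End QuotientLift.

(** A family inside the preimage of [U'] is pushed forward to a family inside [U']. Then [f] induces
    a continuous surjection between the two quotients, and the induction applies to it.
    Commutativity makes every subgroup normal. *)
Lemma SSGP_image n (G G' : topologicalGroupType) (f : G -> G') :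
    (forall x y : G, x * y = y * x) -> group_morph f -> continuous f ->
    (forall y, exists x, f x = y) ->
  SSGP n G -> SSGP n G'.
Proof.
elim: n G G' f => [|n IH] G G' f cG fM fc fsurj.
  by move=> G1 y; have [x <-] := fsurj y; rewrite (G1 x) group_morph1.
have cG' (x y : G') : x * y = y * x.
  have [[a <-] [b <-]] := (fsurj x, fsurj y).
  by rewrite -!fM cG.
move=> GS U' nU'; have nU : nbhs (1 : G) (f @^-1` U').
  by apply: fc; rewrite group_morph1.
have [F [Fsub FU [nH HS]]] := GS _ nU.
set F' := [set f @` K | K in F]; exists F'; split.
- by move=> _ [K FK <-]; apply: is_subgroup_image => //; exact: Fsub.
- by move=> _ [K FK <-] _ [x Kx <-]; exact: FU FK _ Kx.
have nH' : is_normal (closed_generated (\bigcup_(K in F') K)).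
  exact: commutative_normal.
exists nH'.
pose g := quotient_proj nH' \o f.
have gM : group_morph g by move=> x y; rewrite /g /= fM quotient_projM.
have gc : continuous g.
  by move=> x W /(@quotient_proj_continuous _ _ nH')/fc.
have gH x : subgroup_set (closed_generated (\bigcup_(K in F) K)) x -> g x = 1.
  (* By continuity [f] maps the closure into the closure, so it suffices to treat the generated
     subgroup. *)
  move=> Hx; apply/esym/quotient_projE; rewrite invg1 mul1g => W /fc nW.
  have [a [/= gena Wa]] := Hx _ nW; exists (f a); split=> //.
  suff: (f @^-1` generated (\bigcup_(K in F') K)) a by [].
  apply: generated_sub gena.
    by apply: is_subgroup_preimage => //; exact: generated_subgroup.
  move=> z [K FK Kz]; apply: sub_generated.
  by exists (f @` K); [exists K | exists z].
apply: (IH _ _ (@quotient_lift _ _ nH _ g)) HS.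
- by move=> x y; exact: quotient_commutative.
- exact: quotient_liftM.
- exact: quotient_lift_continuous.
- move=> u; have [x fx] := fsurj (repr u).
  exists (quotient_proj nH x); rewrite quotient_liftE // /g /= fx.
  exact: quotient_projK.
Qed.

(** * Ascent and descent of SSGP along a map with a section *)

Section Extension.
Variables (G Q : topologicalGroupType) (p : G -> Q) (s : Q -> G).
Hypotheses (cG : forall x y : G, x * y = y * x).
Hypotheses (pM : group_morph p) (sK : cancel s p).

(* [s] need not be a morphism: its defect lies in the kernel of [p]. *)
Lemma SSGP_extension n :
    (forall W, nbhs (1 : G) W -> nbhs (1 : Q) (s @^-1` W)) ->
    (forall U, nbhs (1 : G) U -> forall x, p x = 1 ->
       closure (generated (\bigcup_(K in [set K | is_subgroup K /\ K `<=` U]) K)) x) ->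
  SSGP n Q -> SSGP n.+1 G.
Proof.
move=> sc small QS U nU; exists [set K | is_subgroup K /\ K `<=` U].
split=> [K []|K []|] //; set A := \bigcup_(K in _) K.
have nH : is_normal (closed_generated A) by exact: commutative_normal.
exists nH.
have eqH x y : p x = p y -> quotient_proj nH x = quotient_proj nH y.
  move=> pxy; apply/quotient_projE; apply: small => //.
  by rewrite pM group_morphV // pxy mulVg.
have cQ (x y : Q) : x * y = y * x by rewrite -[x]sK -[y]sK -!pM cG.
(* The kernel of [p] lies in [H] by [small], so [s] becomes a morphism modulo [H]. It is onto, which
   exhibits the quotient as an image of [Q]. *)
have hM : group_morph (quotient_proj nH \o s).
  move=> x y /=; rewrite -[RHS]quotient_projM; apply: eqH.
  by rewrite pM !sK.
apply: (SSGP_image cQ hM _ _ QS).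
  by apply: group_morph_continuous => // W /(@quotient_proj_continuous _ _ nH)/sc.
move=> u; exists (p (repr u)); rewrite -[RHS]quotient_projK /=.
by apply: eqH; rewrite sK.
Qed.

(** A family inside [U] lies in the kernel of [p], which is closed since [Q] is Hausdorff. Hence [p]
    factors through the quotient, onto [Q] because of the section. *)
Lemma SSGP_small_in_kernel n (U : set G) :
    continuous p -> nbhs (1 : G) U ->
    (forall K x, is_subgroup K -> K `<=` U -> K x -> p x = 1) ->
  SSGP n.+1 G -> SSGP n Q.
Proof.
move=> pc nU Uker /(_ U nU)[F [Fsub FU [nH HS]]].
have pH x : subgroup_set (closed_generated (\bigcup_(K in F) K)) x -> p x = 1.
  move=> Hx; apply: (@topgroup_hausdorff Q) => A B nA nB.
  have [a [/= gena Aa]] := Hx _ (pc _ _ nA).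
  have pa : p a = 1.
    suff: (p @^-1` [set 1]) a by [].
    apply: generated_sub gena; last first.
      by move=> z [K FK Kz]; exact: (Uker K z (Fsub _ FK) (FU _ FK) Kz).
    apply: is_subgroup_preimage => //.
    by split=> // [y z -> ->|y ->]; [rewrite mulg1 | rewrite invg1].
  by exists 1; split; [rewrite -pa | exact: nbhs_singleton].
apply: (SSGP_image (f := @quotient_lift _ _ nH _ p)) HS.
- by move=> x y; exact: quotient_commutative.
- exact: quotient_liftM.
- exact: quotient_lift_continuous.
- by move=> q; exists (quotient_proj nH (s q)); rewrite quotient_liftE.
Qed.

End Extension.
End TopologicalGroups.

(** * Topological groups from norms *)

Section NormedGroups.
Local Open Scope ring_scope.
Import Order.TTheory GRing.Theory Num.Theory.

(** Amounts to a translation-invariant metric [gnorm (x - y)]. Without homogeneity, all multiples of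
    a nonzero element can stay close to 0. *)
Record normedGroup (R : realType) := NormedGroup {
  normed_sort :> zmodType;
  gnorm : normed_sort -> R;
  gnorm0 : gnorm 0 = 0;
  gnorm0_eq0 : forall x, gnorm x = 0 -> x = 0;
  gnormN : forall x, gnorm (- x) = gnorm x;
  ler_gnormD : forall x y, gnorm (x + y) <= gnorm x + gnorm y }.

Variables (R : realType) (V : normedGroup R).
Implicit Types x y : V.

Lemma gnorm_ge0 x : 0 <= gnorm x.
Proof. by have := ler_gnormD x (- x); rewrite subrr gnorm0 gnormN; lra. Qed.

Lemma gnorm_gt0 x : x != 0 -> 0 < gnorm x.
Proof.
move=> x0; rewrite lt_neqAle gnorm_ge0 andbT eq_sym.
by apply: contra_neq x0; exact: gnorm0_eq0.
Qed.

Lemma gnormB x y : gnorm (x - y) = gnorm (y - x).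
Proof. by rewrite -gnormN opprB. Qed.

(** A copy of [V] that carries the multiplicative structure and the metric topology. Its operations
    are convertible to the additive ones. *)
Definition norm_group : Type := V.

HB.instance Definition _ := Choice.on norm_group.

HB.instance Definition _ := isGroup.Build norm_group
  (@addrA V) (@add0r V) (@addr0 V) (@addNr V) (@subrr V).

Definition norm_nbhs (x : norm_group) : set_system norm_group :=
  [set A | exists2 e : R, 0 < e & forall y : V, gnorm (y - x) < e -> A y].

HB.instance Definition _ := hasNbhs.Build norm_group norm_nbhs.

Fact norm_nbhs_filter (x : norm_group) : ProperFilter (nbhs x).
Proof.
constructor; first by move=> [e e0 /(_ x)]; rewrite subrr gnorm0; exact.
constructor.
- by exists 1.
- move=> A B [e e0 eA] [d d0 dB]; exists (Num.min e d).
    by rewrite lt_min e0 d0.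
  by move=> y; rewrite lt_min => /andP[ye yd]; split; [exact: eA | exact: dB].
- by move=> A B AB [e e0 eA]; exists e => // y /eA/AB.
Qed.

Fact norm_nbhs_singleton (x : norm_group) (A : set norm_group) :
  nbhs x A -> A x.
Proof. by move=> [e e0]; apply; rewrite subrr gnorm0. Qed.

Fact norm_nbhs_nbhs (x : norm_group) (A : set norm_group) :
  nbhs x A -> nbhs x (nbhs^~ A).
Proof.
move=> [e e0 eA]; exists (e / 2); first lra.
move=> y yx; exists (e / 2); first lra.
move=> z zy; apply: eA.
have := ler_gnormD ((z : V) - y) ((y : V) - x); rewrite addrA subrK.
by move=> /le_lt_trans; apply; rewrite [ltRHS]splitr ltrD.
Qed.

HB.instance Definition _ := Nbhs_isNbhsTopological.Build norm_group
  norm_nbhs_filter norm_nbhs_singleton norm_nbhs_nbhs.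

Lemma nbhs1_normE (A : set norm_group) :
  nbhs (1%g : norm_group) A <->
  exists2 e : R, 0 < e & forall y : V, gnorm y < e -> A y.
Proof.
by split=> -[e e0 eA]; exists e => // y ye; apply: eA; move: ye; rewrite subr0.
Qed.

Fact norm_group_mulg_continuous :
  continuous (fun xy : norm_group * norm_group => (xy.1 * xy.2)%g : norm_group).
Proof.
move=> [x y] W [e e0 eW].
exists ([set z : norm_group | gnorm ((z : V) - x) < e / 2],
        [set z : norm_group | gnorm ((z : V) - y) < e / 2]).
  by split; exists (e / 2) => //; lra.
move=> [a b] [/= ax bx]; apply: eW.
have := ler_gnormD ((a : V) - x) ((b : V) - y).
rewrite addrACA -opprD => /le_lt_trans; apply; lra.
Qed.

Fact norm_group_invg_continuous :
  continuous (fun x : norm_group => (x^-1)%g : norm_group).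
Proof.
move=> x W [e e0 eW]; exists e => // y yx; apply: eW.
by rewrite -gnormN opprD !opprK.
Qed.

Fact norm_group_hausdorff : hausdorff_space norm_group.
Proof.
move=> x y xy; apply/eqP; rewrite -[x == y](@subr_eq0 V); apply/eqP.
apply: gnorm0_eq0; apply/eqP; rewrite eq_le gnorm_ge0 andbT leNgt.
apply/negP => d0; set d := gnorm _ in d0.
have d2 : 0 < d / 2 by rewrite divr_gt0.
have nb (t : norm_group) : nbhs t [set z : norm_group | gnorm ((z : V) - t) < d / 2].
  by exists (d / 2).
have [z [/= zx zy]] := xy _ _ (nb x) (nb y).
have := ler_gnormD ((x : V) - z) ((z : V) - y).
rewrite addrA subrK gnormB -/d; lra.
Qed.

HB.instance Definition _ := isHausdorffTopologicalGroup.Build norm_group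
  norm_group_mulg_continuous norm_group_invg_continuous norm_group_hausdorff.

End NormedGroups.

(** * Means of periodic sequences *)

Section PeriodicMean.
Local Open Scope ring_scope.
Import Order.TTheory GRing.Theory Num.Theory.

Definition periodic T (p : nat) (f : nat -> T) : Prop :=
  (0 < p)%N /\ forall i, f (i + p)%N = f i.

Lemma periodic_comp T T' (g : T -> T') p (f : nat -> T) :
  periodic p f -> periodic p (fun i => g (f i)).
Proof. by move=> [p0 fp]; split=> // i; rewrite fp. Qed.

Lemma periodicMl T p q (f : nat -> T) :
  (0 < q)%N -> periodic p f -> periodic (q * p) f.
Proof.
move=> q0 [p0 fp]; split=> [|i]; first by rewrite muln_gt0 q0.
elim: q {q0} i => [|q IH] i; first by rewrite mul0n addn0.
by rewrite mulSn addnA IH.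
Qed.

Lemma periodicMr T p q (f : nat -> T) :
  (0 < q)%N -> periodic p f -> periodic (p * q) f.
Proof. by rewrite mulnC; exact: periodicMl. Qed.

Lemma periodic2 T T' p q (f : nat -> T) (g : nat -> T') :
    periodic p f -> periodic q g ->
  [/\ (0 < p * q)%N, periodic (p * q) f & periodic (p * q) g].
Proof.
move=> fp gq; split; first by rewrite muln_gt0 (proj1 fp) (proj1 gq).
  by apply: periodicMr => //; case: gq.
by apply: periodicMl => //; case: fp.
Qed.

Lemma periodic_modn T p (f : nat -> T) i : periodic p f -> f (i %% p)%N = f i.
Proof.
move=> fp; have [p0 _] := fp; rewrite [in RHS](divn_eq i p) addnC.
have [->|q0] := posnP (i %/ p)%N; first by rewrite mul0n addn0.
by have [_ ->] := periodicMl q0 fp.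
Qed.

Variable R : realType.
Implicit Types F : nat -> R.

Lemma sum_periodic p q F : periodic p F ->
  \sum_(0 <= i < q * p) F i = (\sum_(0 <= i < p) F i) *+ q.
Proof.
move=> Fp; elim: q => [|q IH]; first by rewrite mul0n big_geq.
rewrite mulSn (@big_cat_nat _ _ _ p) ?leq_addr//= mulrS; congr (_ + _).
rewrite -{1}[p]add0n big_addn addKn -IH; apply: eq_bigr => i _.
by rewrite (proj2 Fp).
Qed.

(* [mean] is a junk value unless [F] is periodic; see [meanE]. *)
Definition mean F : R :=
  let p := xget 1%N [set p | periodic p F] in (\sum_(0 <= i < p) F i) / p%:R.

(** Any two periods give the same mean: both sums are compared over the product of the periods. *)
Lemma meanE p F : periodic p F -> mean F = (\sum_(0 <= i < p) F i) / p%:R.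
Proof.
move=> Fp; rewrite /mean; case: xgetP => [q _ Fq|/(_ p)//].
have [p0 q0] : p%:R != 0 :> R /\ q%:R != 0 :> R.
  by rewrite !pnatr_eq0 -!lt0n (proj1 Fp) (proj1 Fq).
apply/eqP; rewrite eqr_div // !mulr_natr -!sum_periodic // mulnC.
by [].
Qed.

Lemma ler_mean p F G : periodic p F -> periodic p G ->
  (forall i, F i <= G i) -> mean F <= mean G.
Proof.
move=> Fp Gp FG; rewrite (meanE Fp) (meanE Gp) ler_wpM2r ?invr_ge0//.
exact: ler_sum.
Qed.

Lemma meanD p F G : periodic p F -> periodic p G ->
  mean (fun i => F i + G i) = mean F + mean G.
Proof.
move=> Fp Gp; rewrite (meanE Fp) (meanE Gp) (@meanE p) ?big_split ?mulrDl//=.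
by case: Fp Gp => p0 Fp [_ Gp]; split=> // i; rewrite Fp Gp.
Qed.

Lemma mean_cst c : mean (fun=> c) = c.
Proof.
rewrite (@meanE 1); first by rewrite big_nat1 divr1.
by [].
Qed.

Lemma mean_eq0 p F : periodic p F -> (forall i, 0 <= F i) ->
  mean F = 0 -> forall i, F i = 0.
Proof.
move=> Fp F0; have [p0 _] := Fp; rewrite (meanE Fp) => /eqP.
rewrite mulf_eq0 invr_eq0 pnatr_eq0 -[p == _]negbK -lt0n p0 orbF big_mkord.
rewrite psumr_eq0 // => /allP F00 i; rewrite -(periodic_modn i Fp).
by have := F00 (Ordinal (ltn_pmod i p0)) (mem_index_enum _) => /eqP.
Qed.

(** [F] is dominated by the indicator of the class of [j] modulo [m], whose mean is [1/m]. *)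
Lemma mean_residue_le p m j F : (0 < m)%N -> (j < m)%N -> periodic p F ->
    (forall i, F i <= 1) -> (forall i, (i %% m)%N != j -> F i = 0) ->
  mean F <= m%:R^-1.
Proof.
move=> m0 jm Fp F1 Fj; pose G i : R := ((i %% m)%N == j)%:R.
have Gm : periodic m G by split=> // i; rewrite /G modnDr.
have [pm0 Fpm Gpm] := periodic2 Fp Gm.
have FG i : F i <= G i.
  by rewrite /G; case: eqP => [_|/eqP/Fj->]; [exact: F1 | exact: lexx].
apply: le_trans (ler_mean Fpm Gpm FG) _.
rewrite (meanE Gm) big_mkord (bigD1 (Ordinal jm)) //= big1 => [|i ij].
  by rewrite /G modn_small // eqxx addr0 mul1r.
rewrite /G modn_small //; apply/eqP; rewrite pnatr_eq0 eqb0.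
by apply: contra_neq ij => ij; apply: val_inj.
Qed.

End PeriodicMean.

(** * Truncated supremum norm *)

Section TruncatedSupNorm.
Local Open Scope ring_scope.
Import Order.TTheory GRing.Theory Num.Theory.
Variables (R : realType) (T : Type) (t0 : T).
Implicit Types u v : T -> R.

(** Truncation keeps the supremum finite for arbitrary [u] and bounds it by 1 on all multiples of
    [u]. *)
Definition tsup u : R := sup (range (fun t => Num.min 1 `|u t|)).

Lemma tsup_le u c : (forall t, Num.min 1 `|u t| <= c) -> tsup u <= c.
Proof.
move=> uc; apply: ge_sup => [|_ [t _ <-]//].
by exists (Num.min 1 `|u t0|), t0.
Qed.

Lemma le_tsup u t : Num.min 1 `|u t| <= tsup u.
Proof.
apply: ub_le_sup; last by exists t.
by exists 1 => _ [s _ <-]; rewrite ge_min lexx.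
Qed.

Lemma tsup_le1 u : tsup u <= 1.
Proof. by apply: tsup_le => t; rewrite ge_min lexx. Qed.

Lemma tsup_ge0 u : 0 <= tsup u.
Proof. by apply: le_trans (le_tsup u t0); rewrite le_min ler01 normr_ge0. Qed.

Lemma tsup0 : tsup 0 = 0.
Proof.
apply/eqP; rewrite eq_le tsup_ge0 andbT; apply: tsup_le => t.
by rewrite normr0 ge_min lexx orbT.
Qed.

Lemma tsup_eq0 u : tsup u = 0 -> u = 0.
Proof.
move=> u0; apply/funext => t; apply/eqP; rewrite -normr_le0.
by have := le_tsup u t; rewrite u0 ge_min ler10.
Qed.

Lemma tsupN u : tsup (- u) = tsup u.
Proof.
rewrite /tsup; suff -> : (fun t => Num.min 1 `|(- u) t|) = fun t => Num.min 1 `|u t|.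
  by [].
by apply/funext => t; rewrite -[(- u) t]/(- u t) normrN.
Qed.

Lemma tsupD u v : tsup (u + v) <= tsup u + tsup v.
Proof.
apply: tsup_le => t; apply: le_trans (lerD (le_tsup u t) (le_tsup v t)).
rewrite -[(u + v) t]/(u t + v t); have := ler_normD (u t) (v t).
have := normr_ge0 (u t); have := normr_ge0 (v t).
by rewrite !minEle; do 3 case: ifPn; lra.
Qed.

End TruncatedSupNorm.

Arguments tsup0 {R T}.

(** * The cover of a normed group *)

Section Cover.
Local Open Scope ring_scope.
Import Order.TTheory GRing.Theory Num.Theory.
Variables (R : realType) (Q : normedGroup R).

(** An unreduced formal integer combination of elements of [Q]; letters may repeat. *)
Definition word := seq (int * Q).

Definition weval (V : zmodType) (u : Q -> V) (s : word) : V :=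
  \sum_(x <- s) u x.2 *~ x.1.

Definition wopp (s : word) : word := [seq (- x.1, x.2) | x <- s].

Lemma weval_nil (V : zmodType) (u : Q -> V) : weval u [::] = 0.
Proof. exact: big_nil. Qed.

Lemma weval_cat (V : zmodType) (u : Q -> V) s t :
  weval u (s ++ t) = weval u s + weval u t.
Proof. exact: big_cat. Qed.

Lemma weval_opp (V : zmodType) (u : Q -> V) s : weval u (wopp s) = - weval u s.
Proof. by rewrite /weval big_map -sumrN; apply: eq_bigr => x _; rewrite mulrNz. Qed.

Definition wcoef (s : word) (q : Q) : int := \sum_(x <- s | x.2 == q) x.1.

Lemma weval_coef (V : zmodType) (u : Q -> V) s :
  weval u s = \sum_(q <- undup (map snd s)) u q *~ wcoef s q.
Proof.
transitivity (\sum_(q <- undup (map snd s)) \sum_(x <- s | x.2 == q) u q *~ x.1).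
  rewrite (exchange_big_dep predT) //= /weval [LHS]big_seq [RHS]big_seq.
  apply: eq_bigr => x xs; rewrite big_mkcond (bigD1_seq x.2) ?undup_uniq //=; last first.
    by rewrite mem_undup map_f.
  by rewrite eqxx big1 ?addr0 // => q /negPf qx; rewrite eq_sym qx.
by apply: eq_bigr => q _; rewrite mulrz_sumr.
Qed.

(** * Lipschitz functions separate words *)

Definition lipschitz1 (f : Q -> R) : Prop :=
  forall x y, `|f x - f y| <= gnorm (x - y).

Definition lip1 := {f : Q -> R | lipschitz1 f}.

Lemma cst_lipschitz1 c : lipschitz1 (fun=> c).
Proof. by move=> x y; rewrite subrr normr0 gnorm_ge0. Qed.

Definition lip1_cst c : lip1 := exist _ _ (cst_lipschitz1 c).

Lemma bump_lipschitz1 r q : lipschitz1 (fun x => Num.max 0 (r - gnorm (x - q))).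
Proof.
move=> x y; have := ler_gnormD (x - y) (y - q); have := ler_gnormD (y - x) (x - q).
rewrite !addrA !subrK (gnormB y x) !maxEle ler_norml.
by do 2 case: ifPn; lra.
Qed.

Lemma separation_radius (s : seq Q) q :
  exists2 r : R, 0 < r & forall x, x \in s -> x != q -> r <= gnorm (x - q).
Proof.
elim: s => [|y s [r r0 rs]]; first by exists 1.
have [->|yq] := eqVneq y q.
  by exists r => // x; rewrite inE => /predU1P[->|/rs]//; rewrite eqxx.
exists (Num.min r (gnorm (y - q))).
  by rewrite lt_min r0 gnorm_gt0 // subr_eq0.
move=> x; rewrite inE => /predU1P[-> _|xs xq]; first by rewrite ge_min lexx orbT.
by rewrite ge_min rs.
Qed.

(* Bump functions at the letters of [s] recover the coefficients of [s]. *)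
Lemma weval_lip1_eq0 (s : word) :
  (forall f : lip1, weval (sval f) s = 0) -> weval id s = 0.
Proof.
move=> s0; rewrite weval_coef big_seq big1 // => q qs.
have [r r0 rs] := separation_radius (undup (map snd s)) q.
(* This bump has height [r] at [q] and vanishes at the other letters, so its value on [s] is [r]
   times the coefficient of [q]. *)
have := s0 (exist _ _ (bump_lipschitz1 r q)).
rewrite weval_coef /= (bigD1_seq q) ?undup_uniq //= big_seq_cond big1 => [|x].
  rewrite subrr gnorm0 subr0 addr0 max_r ?ltW // => /eqP.
  by rewrite mulrz_eq0 (gt_eqF r0) orbF => /eqP ->; rewrite mulr0z.
by move=> /andP[xs xq]; rewrite max_l ?mul0rz // subr_le0 rs.
Qed.

(* The free abelian group on [Q] is not constructed: an element of it is recorded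
   by its image in [Q] and its values on the 1-Lipschitz functions, which
   determine it; words serve as representatives. *)
Definition cover_ambient : zmodType := (Q * (nat -> lip1 -> R))%type.

(** The component [x.1] does not depend on [i]: all terms lie over the same element of [Q]. *)
Definition represents (s : nat -> word) (x : cover_ambient) : Prop :=
  forall i, x.1 = weval id (s i) /\ forall f, x.2 i f = weval (sval f) (s i).

Definition in_cover (x : cover_ambient) : Prop :=
  exists p s, periodic p s /\ represents s x.

Definition cover_pred : {pred cover_ambient} := fun x => `[< in_cover x >].

Lemma in_coverP x : reflect (in_cover x) (x \in cover_pred).
Proof. exact: asboolP. Qed.

Fact cover_zmod_closed : zmod_closed cover_pred.
Proof.
split.
  apply/in_coverP; exists 1, (fun=> [::]); split=> // i.
  by split=> [|f]; rewrite weval_nil.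
move=> x y /in_coverP[p [s [sp sx]]] /in_coverP[q [t [tq ty]]]; apply/in_coverP.
have [pq0 [_ spq] [_ tpq]] := periodic2 sp tq.
exists (p * q)%N, (fun i => s i ++ wopp (t i)); split.
  by split=> // i; rewrite spq tpq.
move=> i; have [x1 x2] := sx i; have [y1 y2] := ty i.
split=> [|f]; rewrite weval_cat weval_opp; first by rewrite -x1 -y1.
by rewrite -x2 -y2.
Qed.

HB.instance Definition _ := GRing.isZmodClosed.Build cover_ambient cover_pred
  cover_zmod_closed.

Definition cover_type := {x : cover_ambient | x \in cover_pred}.

HB.instance Definition _ := SubChoice.on cover_type.
HB.instance Definition _ := [SubChoice_isSubZmodule of cover_type by <:].

Definition cproj (x : cover_type) : Q := (val x).1.
Definition cfun (x : cover_type) : nat -> lip1 -> R := (val x).2.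

Lemma cprojD x y : cproj (x + y) = cproj x + cproj y.
Proof. by rewrite /cproj raddfD. Qed.

Lemma cfunD x y i : cfun (x + y) i = cfun x i + cfun y i.
Proof. by rewrite /cfun raddfD. Qed.

Lemma cprojN x : cproj (- x) = - cproj x.
Proof. by rewrite /cproj raddfN. Qed.

Lemma cfunN x i : cfun (- x) i = - cfun x i.
Proof. by rewrite /cfun raddfN. Qed.

Lemma cproj0 : cproj 0 = 0.
Proof. by rewrite /cproj raddf0. Qed.

Lemma cfun0 i : cfun 0 i = 0.
Proof. by rewrite /cfun raddf0. Qed.

Lemma cover_eq x y : cproj x = cproj y -> cfun x = cfun y -> x = y.
Proof.
rewrite /cproj /cfun => xy1 xy2; apply: val_inj.
by case: (val x) (val y) xy1 xy2 => [a b] [c d] /= -> ->.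
Qed.

Lemma cfun_periodic x : exists p, periodic p (cfun x).
Proof.
have [p [s [sp sx]]] := in_coverP _ (valP x); exists p; split; first by case: sp.
by move=> i; apply/funext => f; rewrite /cfun !(proj2 (sx _)) (proj2 sp).
Qed.

Lemma cfun_eq0_cproj x i : cfun x i = 0 -> cproj x = 0.
Proof.
have [p [s [_ sx]]] := in_coverP _ (valP x) => x0; have [x1 x2] := sx i.
rewrite /cproj x1; apply: weval_lip1_eq0 => f.
by rewrite -x2; exact: (congr1 (@^~ f) x0).
Qed.

(** * The norm of the cover *)

Definition cnorm (x : cover_type) : R :=
  gnorm (cproj x) + mean (fun i => tsup (cfun x i)).

Lemma cfun_mean_ge0 x : 0 <= mean (fun i => tsup (cfun x i)).
Proof.
have [p px] := cfun_periodic x; rewrite -(mean_cst (0 : R)).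
apply: (@ler_mean _ p) => [||i].
- by split=> //; case: px.
- exact: periodic_comp px.
- exact: tsup_ge0 (lip1_cst 0) _.
Qed.

Fact cnorm0 : cnorm 0 = 0.
Proof.
rewrite /cnorm cproj0 gnorm0 add0r -[RHS](mean_cst 0); congr mean.
by apply/funext => i; rewrite cfun0 (tsup0 (lip1_cst 0)).
Qed.

Fact cnorm0_eq0 x : cnorm x = 0 -> x = 0.
Proof.
move/eqP; rewrite paddr_eq0 ?gnorm_ge0 ?cfun_mean_ge0 // => /andP[/eqP x1 /eqP x2].
apply: cover_eq; first by rewrite cproj0; exact: gnorm0_eq0.
have [p px] := cfun_periodic x; apply/funext => i; rewrite cfun0.
apply: tsup_eq0.
apply: (mean_eq0 (periodic_comp (@tsup _ _) px) _ x2) => j.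
exact: tsup_ge0 (lip1_cst 0) _.
Qed.

Fact cnormN x : cnorm (- x) = cnorm x.
Proof.
rewrite /cnorm cprojN gnormN; congr (_ + mean _).
by apply/funext => i; rewrite cfunN tsupN.
Qed.

Fact ler_cnormD x y : cnorm (x + y) <= cnorm x + cnorm y.
Proof.
rewrite /cnorm addrACA cprojD lerD ?ler_gnormD //.
have [p px] := cfun_periodic x; have [q qy] := cfun_periodic y.
have [pq0 pqx pqy] := periodic2 px qy.
have tx := periodic_comp (@tsup _ _) pqx; have ty := periodic_comp (@tsup _ _) pqy.
rewrite -(meanD tx ty); apply: (@ler_mean _ (p * q)) => [||i].
- by split=> // i; rewrite !cfunD (proj2 pqx) (proj2 pqy).
- by split=> // i; rewrite (proj2 pqx) (proj2 pqy).
- by rewrite cfunD; exact: tsupD (lip1_cst 0) _ _.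
Qed.

Definition cover : normedGroup R :=
  NormedGroup cnorm0 cnorm0_eq0 cnormN ler_cnormD.

Fact cst_in_cover (s : word) :
  ((weval id s, fun _ f => weval (sval f) s) : cover_ambient) \in cover_pred.
Proof. by apply/in_coverP; exists 1%N, (fun=> s). Qed.

Definition cover_cst (s : word) : cover_type :=
  exist (fun x => x \in cover_pred) _ (cst_in_cover s).

(** The constant function 1 detects the generator of 0, even when [Q] is trivial. *)
Lemma cover_nontrivial : exists x : cover_type, x != 0.
Proof.
exists (cover_cst [:: (1, 0)]); apply/eqP => /(congr1 (fun x => cfun x 0 (lip1_cst 1))).
rewrite cfun0 /cfun /= /weval big_seq1 /= mulr1z => /eqP.
by rewrite oner_eq0.
Qed.

Definition csect (q : Q) : cover_type := cover_cst [:: (1, q); (-1, 0)].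

Lemma csectK : cancel csect cproj.
Proof.
move=> q; rewrite /cproj /= /weval big_cons big_seq1 /=.
by rewrite mulrN1z oppr0 addr0 mulr1z.
Qed.

(** Subtracting the generator of 0 turns the value at [f] into [f q - f 0], which is at most
    [gnorm q] in absolute value. The other [gnorm q] comes from the projection. *)
Lemma cnorm_csect q : cnorm (csect q) <= gnorm q *+ 2.
Proof.
rewrite /cnorm csectK mulr2n lerD // -[leRHS]mean_cst.
apply: (@ler_mean _ 1) => // i; apply: (tsup_le (lip1_cst 0)) => f.
rewrite ge_min /cfun /= /weval big_cons big_seq1 /= mulr1z mulrN1z.
by apply/orP; right; have := svalP f q 0; rewrite subr0.
Qed.

Lemma cfun_mulrn x k i f : cfun (x *+ k) i f = cfun x i f *+ k.
Proof.
elim: k => [|k IH]; first by rewrite !mulr0n cfun0.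
by rewrite !mulrS cfunD -IH.
Qed.

(** If [cproj x] is nonzero then no term vanishes, and a single multiple brings every term of a
    period to truncated norm 1. The mean is then at least 1. *)
Lemma cproj_bounded_multiples x :
  (forall k, cnorm (x *+ k) < 1) -> cproj x = 0.
Proof.
move=> xlt1; apply: contrapT => x0.
have fi i : exists f, cfun x i f != 0.
  apply: contrapT => fi0; apply: x0; apply: (@cfun_eq0_cproj _ i).
  apply/funext => f; apply: contrapT => /eqP xif.
  by apply: fi0; exists f.
have [p px] := cfun_periodic x; have [p0 _] := px.
have bound n : exists k, forall i, (i < n)%N -> 1 <= tsup (cfun (x *+ k) i).
  (* With one function fixed per index, the untruncated value grows with [k], so the multipliers
     found for different indices can be added. *)
  suff [k kP] : exists k, forall i, (i < n)%N -> exists f, 1 <= `|cfun x i f| *+ k.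
    exists k => i /kP[f fk].
    by apply: le_trans (le_tsup _ f); rewrite cfun_mulrn normrMn le_min lexx.
  elim: n => [|n [k kP]]; first by exists 0%N.
  have [f fn0] := fi n.
  have [l lP] : exists l, 1 <= `|cfun x n f| *+ l.
    exists (Num.truncn `|cfun x n f|^-1).+1.
    rewrite -mulr_natr -ler_pdivrMl ?normr_gt0 // mulr1 ltW //.
    exact: truncnS_gt.
  exists (k + l)%N => i; rewrite ltnS leq_eqVlt => /predU1P[->|/kP[g gk]].
    by exists f; rewrite mulrnDr (le_trans lP) // lerDr mulrn_wge0.
  by exists g; rewrite mulrnDr (le_trans gk) // lerDl mulrn_wge0.
have [k kP] := bound p; have := xlt1 k; rewrite ltNge => /negP; apply.
have xkp : periodic p (fun i => tsup (cfun (x *+ k) i)).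
  split=> // i; congr tsup; apply/funext => f.
  by rewrite !cfun_mulrn (proj2 px).
rewrite /cnorm ler_wpDl ?gnorm_ge0 // -[leLHS]mean_cst.
apply: (@ler_mean _ p) => // i.
by rewrite -(periodic_modn i xkp); apply: kP; rewrite ltn_mod.
Qed.

(** * Splitting a kernel element by residue classes *)

Section Residues.
Variables (x : cover_type) (x0 : cproj x = 0) (m : nat) (m0 : (0 < m)%N).

Definition residue_fun (j i : nat) : lip1 -> R :=
  if (i %% m)%N == j then cfun x i else 0.

(** Off the class of [j] the empty word is used; it lies over 0, as [x] does by [x0]. *)
Lemma residue_in_cover j :
  ((0 : Q, residue_fun j) : cover_ambient) \in cover_pred.
Proof.
have [p [s [sp sx]]] := in_coverP _ (valP x).
apply/in_coverP; exists (p * m)%N.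
exists (fun i => if (i %% m)%N == j then s i else [::]); split.
  (* The constant sequence 0, viewed with period [m], serves only to pass to the period [p * m],
     which respects residues modulo [m]. *)
  have [pm0 [_ pms] _] := periodic2 sp (conj m0 (fun i : nat => erefl (0%N))).
  by split=> // i; rewrite pms addnC modnMDl.
move=> i; have [x1 x2] := sx i; rewrite /residue_fun.
by case: ifP => ij; split=> [|f] /=; rewrite ?weval_nil ?ij // -?x1 -?x2 -?x0.
Qed.

Definition residue j : cover_type :=
  exist (fun x => x \in cover_pred) _ (residue_in_cover j).

Lemma sum_residue : x = \sum_(j < m) residue j.
Proof.
have sumE (I : Type) (r : seq I) (F : I -> cover_type) :
    cproj (\sum_(a <- r) F a) = \sum_(a <- r) cproj (F a) /\
    forall i f, cfun (\sum_(a <- r) F a) i f = \sum_(a <- r) cfun (F a) i f.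
  split=> [|i f].
    by elim/big_rec2: _ => [|a u v _ <-]; rewrite ?cproj0 ?cprojD.
  by elim/big_rec2: _ => [|a u v _ <-]; rewrite ?cfun0 ?cfunD.
apply: cover_eq; first by rewrite (proj1 (sumE _ _ _)) x0 big1.
apply/funext => i; apply/funext => f; rewrite (proj2 (sumE _ _ _)).
rewrite (bigD1 (Ordinal (ltn_pmod i m0))) //= big1 ?addr0; first last.
  move=> j ij; rewrite /cfun /= /residue_fun; case: eqP => // ijE.
  by case/eqP: ij; exact: val_inj.
by rewrite {2}/cfun /= /residue_fun eqxx.
Qed.

(** The bound is uniform in [k]: the multiple lies over 0, is supported on one class modulo [m], and
    its terms have truncated norm at most 1. *)
Lemma cnorm_residue_mulrn j k : (j < m)%N -> cnorm (residue j *+ k) <= m%:R^-1.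
Proof.
move=> jm; have -> : cnorm (residue j *+ k) =
    mean (fun i => tsup (cfun (residue j *+ k) i)).
  rewrite /cnorm; suff -> : cproj (residue j *+ k) = 0 by rewrite gnorm0 add0r.
  by elim: k => [|k IH]; rewrite ?mulr0n ?cproj0 // mulrS cprojD IH addr0.
have [p px] := cfun_periodic (residue j *+ k).
apply: (mean_residue_le m0 jm (periodic_comp (@tsup _ _) px)) => [i|i ij].
  exact: tsup_le1 (lip1_cst 0) _.
suff -> : cfun (residue j *+ k) i = 0 by rewrite (tsup0 (lip1_cst 0)).
apply/funext => f; rewrite cfun_mulrn {1}/cfun /= /residue_fun (negbTE ij).
exact: mul0rn.
Qed.

End Residues.

End Cover.

(** * Covers and SSGP *)

Section Tower.
Local Open Scope ring_scope.
Import Order.TTheory GRing.Theory Num.Theory.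
Variable R : realType.

Lemma norm_group_commutative (V : normedGroup R) (x y : norm_group V) :
  (x * y = y * x)%g.
Proof. exact: (@addrC V). Qed.

Definition trivial_normedGroup : normedGroup R.
Proof.
refine (@NormedGroup R 'rV[int]_0 (fun=> 0) _ _ _ _) => // [x _|_ _].
  by rewrite thinmx0.
by rewrite addr0.
Defined.

Lemma trivial_SSGP0 : SSGP 0 (norm_group trivial_normedGroup).
Proof. by move=> x; rewrite [x](@thinmx0 int 1). Qed.

Variable Q : normedGroup R.
Local Notation G := (norm_group (cover Q)).
Local Notation proj := (@cproj R Q : G -> norm_group Q).

Lemma proj_morph : group_morph proj.
Proof. exact: cprojD. Qed.

Lemma cyclic_subgroup (x : cover Q) :
  is_subgroup ([set y | exists k : int, y = x *~ k] : set G).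
Proof.
split=> [|_ _ [k ->] [l ->]|_ [k ->]].
- by exists 0; rewrite mulr0z.
- by exists (k + l); rewrite mulrzDr.
- by exists (- k); rewrite mulrNz.
Qed.

Lemma kernel_small_generated (U : set G) (x : G) :
    nbhs (1%g : G) U -> proj x = 1%g ->
  generated (\bigcup_(K in [set K | is_subgroup K /\ K `<=` U]) K) x.
Proof.
move=> /nbhs1_normE[e e0 eU] x0; set A := \bigcup_(K in _) K.
have [A1 AM _] := generated_subgroup A.
(* With [1/m < e], each residue of [x] modulo [m] generates a cyclic subgroup inside [U]. *)
pose m := (Num.truncn e^-1).+1; have m0 : (0 < m)%N by [].
have me : m%:R^-1 < e by rewrite invf_plt ?posrE ?ltr0n // truncnS_gt.
rewrite (sum_residue x0 m0); apply: (big_ind (generated A)) => // j _.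
apply: sub_generated.
exists ([set y | exists k : int, y = residue x0 m0 j *~ k] : set G); last first.
  by exists 1; rewrite mulr1z.
split=> [|_ [k ->]]; first exact: cyclic_subgroup.
apply: eU; apply: le_lt_trans me.
case: (intP k) => [|n|n].
- by rewrite mulr0z -[0](mulr0n (residue x0 m0 j)); exact: cnorm_residue_mulrn.
- exact: cnorm_residue_mulrn.
- by rewrite mulrNz gnormN; exact: cnorm_residue_mulrn.
Qed.

Lemma cover_SSGP n : SSGP n (norm_group Q) -> SSGP n.+1 G.
Proof.
apply: (@SSGP_extension G _ proj (@csect R Q)) => [x y|||W|U nU x x0].
- exact: norm_group_commutative.
- exact: proj_morph.
- exact: csectK.
- move=> /nbhs1_normE[e e0 eW]; apply/nbhs1_normE; exists (e / 2) => [|y ye].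
    by rewrite divr_gt0.
  apply: eW; apply: le_lt_trans (cnorm_csect y) _.
  by rewrite -mulr_natr -ltr_pdivlMr.
- by apply: subset_closure; exact: kernel_small_generated.
Qed.

Lemma cover_SSGP_inv n : SSGP n.+1 G -> SSGP n (norm_group Q).
Proof.
apply: (@SSGP_small_in_kernel G _ proj (@csect R Q) _ _ _ _ [set x | gnorm x < 1]).
- exact: norm_group_commutative.
- exact: proj_morph.
- exact: csectK.
- apply: group_morph_continuous; first exact: proj_morph.
  move=> W /nbhs1_normE[e e0 eW]; apply/nbhs1_normE; exists e => // y ye.
  (* The projection does not increase norms. *)
  by apply: eW; apply: le_lt_trans ye; rewrite /= lerDl cfun_mean_ge0.
- by apply/nbhs1_normE; exists 1.
- move=> K x [K1 KM _] KU Kx; apply: cproj_bounded_multiples => k; apply: KU.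
  by elim: k => [|k IH]; [exact: K1 | rewrite mulrS; exact: KM].
Qed.

Lemma cover_not_SSGP0 : ~ SSGP 0 G.
Proof. by move=> G1; have [x /eqP] := cover_nontrivial Q; apply; exact: G1. Qed.

End Tower.

Theorem theorem3p5 (n : nat) (hn : (1 <= n)%N) :
  exists G : topologicalGroupType,
    [/\ (forall x y : G, (x * y)%g = (y * x)%g),
        SSGP n G
      & ~ SSGP (n - 1)%N G].
Proof.
(* The norm is kept in the statement so that the cover can be iterated. *)
suff [Q [Qn Qn1]] : exists Q : normedGroup (Rdefinitions.R : realType),
    SSGP n (norm_group Q) /\ ~ SSGP n.-1 (norm_group Q).
  exists (norm_group Q); split; rewrite ?subn1 //.
  exact: norm_group_commutative.
(* The base case is the cover of the trivial group. Each further cover raises membership and, by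
   descent, non-membership by one level. *)
case: n hn => // n _; elim: n => [|n [Q [Qn Qn1]]].
  exists (cover (trivial_normedGroup _)); split; last exact: cover_not_SSGP0.
  exact/cover_SSGP/trivial_SSGP0.
by exists (cover Q); split=> [|/cover_SSGP_inv//]; exact: cover_SSGP.
Qed.
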